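(* Let $R$ be a basic formal matrix ring of order $n$ with coordinate bimodules $B_{i,j}$ and a Nakayama permutation $\pi$. Further, assume that the right socle of $R$ is essential as a right ideal. Then $B_{i,\pi(i)}$ is a faithful left $R_i$-module for any $i\le n$ such that $i\neq\pi(i)$.
   Context: Rings are associative and unital; $J(R)$ is the Jacobson radical. Formal matrix ring of order $n$: given local rings $R_1,\dots,R_n$, $R_i$-$R_j$-bimodules $B_{i,j}$ (coordinate bimodules) with $B_{i,i}=R_i$, and $R_i$-$R_k$-bimodule homomorphisms $\varphi_{i,j,k}\colon B_{i,j}\otimes_{R_j}B_{j,k}\to B_{i,k}$, written $ab:=\varphi_{i,j,k}(a\otimes b)$, where $\varphi_{i,i,j}$ and $\varphi_{i,j,j}$ are the bimodule actions and $(ab)c=a(bc)$ for all $a\in B_{i,j}$, $b\in B_{j,k}$, $c\in B_{k,l}$. The ring $R$ is the set of $n\times n$ matrices whose $(i,j)$ entry lies in $B_{i,j}$, with the usual matrix addition and multiplication. The canonical idempotent $e_i$ is the matrix with $1_{R_i}$ at position $(i,i)$ and zeros elsewhere. $R$ is basic if the right modules $e_1R,\dots,e_nR$ are pairwise non-isomorphic. Nakayama permutation: a basic formal matrix ring $R$ of order $n$ is a ring with a Nakayama permutation $\pi\in S_n$ if for each $i\le n$ one has $soc(e_iR)\cong top(e_{\pi(i)}R)$ as right $R$-modules and $soc(Re_{\pi(i)})\cong top(Re_i)$ as left $R$-modules, where $top(M)=M/MJ(R)$ (resp. $M/J(R)M$). *)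

(* Defs.v *)
From HB Require Import structures.
Set Warnings "-notation-overridden,-ambiguous-paths,-redundant-canonical-projection,-projection-no-head-constant".
From mathcomp Require Import all_boot perm all_algebra.
From mathcomp Require Import boolp classical_sets.

Set Implicit Arguments.
Unset Strict Implicit.
Unset Printing Implicit Defensive.

Import GRing.Theory.
Local Open Scope ring_scope.

(* Throughout, a right module over [S] is a left module over the converse     *)
(* ring [S^c]; thus the left ideals of [S] are the submodules of [S^o], and   *)
(* its right ideals are the submodules of [(S^c)^o].                          *)

Record submodule (S : pzRingType) (V : lmodType S) := Submodule {
  submod_pred :> {pred V};
  submod_predP : GRing.submod_closed submod_pred
}.

HB.instance Definition _ (S : pzRingType) (V : lmodType S) (N : submodule V) :=
  GRing.isSubmodClosed.Build S V (submod_pred N) (submod_predP N).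

Section SubQuotient.
Variables (S : pzRingType) (V : lmodType S) (N : submodule V).

Inductive submod_of : predArgType := SubmodOf (x : V) & x \in N.

Definition submod_val (u : submod_of) : V := let: SubmodOf x _ := u in x.

HB.instance Definition _ := [isSub of submod_of for submod_val].
HB.instance Definition _ := [Choice of submod_of by <:].
HB.instance Definition _ := [SubChoice_isSubLmodule of submod_of by <:].

Definition quotmod : Type := {ideal_quot submod_pred N}.

HB.instance Definition _ := GRing.Zmodule.on quotmod.
HB.instance Definition _ := EqQuotient.on quotmod.

Definition quotmod_scale (a : S) (x : quotmod) : quotmod :=
  \pi_(quotmod)%qT (a *: repr x).

Lemma pi_quotmodP (x y : V) :
  (\pi_(quotmod)%qT x = \pi_(quotmod)%qT y) <-> x - y \in N.
Proof. by rewrite Quotient.idealrBE; split=> [->|/eqP //]. Qed.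

Lemma quotmod_scaleE a (x : V) :
  quotmod_scale a (\pi_(quotmod)%qT x) = \pi_(quotmod)%qT (a *: x).
Proof.
apply/pi_quotmodP; rewrite -scalerBr rpredZ //.
by apply/pi_quotmodP; rewrite reprK.
Qed.

Lemma quotmod_scaleA a b x :
  quotmod_scale a (quotmod_scale b x) = quotmod_scale (a * b) x.
Proof. by rewrite -[x]reprK (quotmod_scaleE b) !quotmod_scaleE scalerA. Qed.

Lemma quotmod_scale1 : left_id 1 quotmod_scale.
Proof. by move=> x; rewrite -[x]reprK quotmod_scaleE scale1r. Qed.

Lemma quotmod_scaleDr : right_distributive quotmod_scale +%R.
Proof.
move=> a x y; rewrite -[x]reprK -[y]reprK -raddfD !quotmod_scaleE.
by rewrite -raddfD scalerDr.
Qed.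

Lemma quotmod_scaleDl x : {morph quotmod_scale^~ x : a b / a + b}.
Proof.
by move=> a b; rewrite -[x]reprK !quotmod_scaleE -raddfD scalerDl.
Qed.

HB.instance Definition _ := GRing.Zmodule_isLmodule.Build S quotmod
  quotmod_scaleA quotmod_scale1 quotmod_scaleDr quotmod_scaleDl.

End SubQuotient.

Definition isomorphic (S : pzRingType) (M M' : lmodType S) : Prop :=
  exists f : {linear M -> M'}, bijective f.

Definition faithful (S : pzRingType) (M : lmodType S) : Prop :=
  forall a : S, (forall x : M, a *: x = 0) -> a = 0.

Definition simple_submod (S : pzRingType) (M : lmodType S)
    (N : submodule M) : Prop :=
  (exists2 x : M, x \in N & x != 0) /\
  (forall N' : submodule M, {subset N' <= N} ->
     (forall x, x \in N' -> x = 0) \/ {subset N <= N'}).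

Definition maximal_submod (S : pzRingType) (M : lmodType S)
    (N : submodule M) : Prop :=
  (exists x : M, x \notin N) /\
  (forall N' : submodule M, {subset N <= N'} ->
     {subset N' <= N} \/ (forall x, x \in N')).

Definition essential (S : pzRingType) (M : lmodType S) (E : submodule M) :
    Prop :=
  forall N : submodule M, (exists2 x : M, x \in N & x != 0) ->
    exists x : M, [/\ x \in N, x \in E & x != 0].

Section CyclicSubmodule.
Variables (S : pzRingType) (M : lmodType S) (v : M).

Definition cyclic_submod_pred : pred M := fun x => `[< exists a : S, x = a *: v >].

Lemma cyclic_submodP x :
  reflect (exists a : S, x = a *: v) (x \in cyclic_submod_pred).
Proof. exact: asboolP. Qed.

Lemma cyclic_submod_closed : GRing.submod_closed cyclic_submod_pred.
Proof.
split=> [|a x y /cyclic_submodP[b ->] /cyclic_submodP[c ->]].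
  by apply/cyclic_submodP; exists 0; rewrite scale0r.
by apply/cyclic_submodP; exists (a * b + c); rewrite scalerDl scalerA.
Qed.

Definition cyclic_submod : submodule M := Submodule cyclic_submod_closed.

End CyclicSubmodule.

Section Socle.
Variables (S : pzRingType) (M : lmodType S).

(* The sum of all simple submodules.                                          *)
Definition socle_pred : pred M := fun x =>
  `[< exists s : seq M, x = \sum_(y <- s) y /\
        forall y, y \in s -> exists2 N : submodule M, simple_submod N & y \in N >].

Lemma socleP x :
  reflect (exists s : seq M, x = \sum_(y <- s) y /\
    forall y, y \in s -> exists2 N : submodule M, simple_submod N & y \in N)
    (x \in socle_pred).
Proof. exact: asboolP. Qed.

Lemma socle_closed : GRing.submod_closed socle_pred.
Proof.
split=> [|a x y /socleP[s [-> sN]] /socleP[t [-> tN]]].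
  by apply/socleP; exists [::]; rewrite big_nil.
apply/socleP; exists ([seq a *: z | z <- s] ++ t); split.
  by rewrite big_cat big_map scaler_sumr.
move=> z; rewrite mem_cat => /orP[/mapP[w /sN[N Ns wN] ->]|/tN //].
by exists N => //; rewrite rpredZ.
Qed.

Definition socle : submodule M := Submodule socle_closed.

End Socle.

(* The intersection of the maximal left ideals; [jacobson_converse] below     *)
(* shows that the maximal right ideals give the same set.                     *)
Definition jacobson (S : pzRingType) : pred S := fun x =>
  `[< forall m : submodule S^o, maximal_submod m -> x \in m >].

Arguments jacobson S : clear implicits.

Section Top.
Variables (S : pzRingType) (M : lmodType S).

(* The finite sums of products of an element of J(S) and an element of M.     *)
Definition radmod_pred : pred M := fun x =>
  `[< exists s : seq (S * M), x = \sum_(p <- s) p.1 *: p.2 /\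
        forall p, p \in s -> p.1 \in jacobson S >].

Lemma radmodP x :
  reflect (exists s : seq (S * M), x = \sum_(p <- s) p.1 *: p.2 /\
    forall p, p \in s -> p.1 \in jacobson S) (x \in radmod_pred).
Proof. exact: asboolP. Qed.

Lemma jacobsonP x :
  reflect (forall m : submodule S^o, maximal_submod m -> x \in m)
    (x \in jacobson S).
Proof. exact: asboolP. Qed.

Lemma jacobsonMl a x : x \in jacobson S -> a * x \in jacobson S.
Proof.
by move=> /jacobsonP xJ; apply/jacobsonP => m /xJ; exact: (@rpredZ S S^o m a x).
Qed.

Lemma radmod_closed : GRing.submod_closed radmod_pred.
Proof.
split=> [|a x y /radmodP[s [-> sJ]] /radmodP[t [-> tJ]]].
  by apply/radmodP; exists [::]; rewrite big_nil.
apply/radmodP; exists ([seq (a * p.1, p.2) | p <- s] ++ t); split.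
  rewrite big_cat big_map scaler_sumr; congr (_ + _).
  by apply: eq_bigr => p _; rewrite scalerA.
move=> p; rewrite mem_cat => /orP[/mapP[q /sJ qJ ->]|/tJ //].
exact: jacobsonMl.
Qed.

Definition radmod : submodule M := Submodule radmod_closed.

Definition topmod : lmodType S := quotmod radmod.

End Top.

(* Exactly one maximal left ideal; equivalently, S/J(S) is a division ring.   *)
Definition local_ring (S : pzRingType) : Prop :=
  exists m : submodule S^o, maximal_submod m /\
    forall m' : submodule S^o, maximal_submod m' -> m' =i m.

Section JacobsonConverse.

Lemma exists_maximal (S : pzRingType) (N : submodule S^o) :
  (1 : S) \notin N ->
  exists2 m : submodule S^o, maximal_submod m & {subset N <= m}.
Proof.
move=> N1.
pose T := {m : submodule S^o | {subset N <= m} /\ (1 : S) \notin m}.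
pose le (m m' : T) := `[< {subset sval m <= sval m'} >].
have NT : {subset N <= N} /\ (1 : S) \notin N by split=> [x|].
have lexx t : le t t by apply/asboolP.
have le_trans r s t : le r s -> le s t -> le r t.
  by move=> /asboolP rs /asboolP st; apply/asboolP => x /rs /st.
case: (@ZL_preorder T (exist _ N NT : T) le lexx le_trans).
  move=> A Atot; have [[t0 At0]|A0] := pselect (exists t, A t); last first.
    by exists (exist _ N NT : T) => s As; case: A0; exists s.
  pose U : pred S^o := fun x => `[< exists2 t : T, A t & x \in sval t >].
  have UP x : reflect (exists2 t : T, A t & x \in sval t) (x \in U).
    exact: asboolP.
  have Ucl : GRing.submod_closed U.
    split; first by apply/UP; exists t0 => //; exact: rpred0.
    move=> a x y /UP[s As xs] /UP[t At yt]; apply/UP.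
    have [/asboolP st|/asboolP ts] := Atot s t As At.
      by exists t => //; rewrite rpredD ?rpredZ// st.
    by exists s => //; rewrite rpredD ?rpredZ// ts.
  have UT : {subset N <= Submodule Ucl} /\ (1 : S) \notin Submodule Ucl.
    split=> [x xN|]; first by apply/UP; exists t0 => //; exact: (svalP t0).1.
    by apply/negP => /UP[t At]; exact/negP/(svalP t).2.
  by exists (exist _ (Submodule Ucl) UT : T) => s As; apply/asboolP => x xs; apply/UP; exists s.
move=> [m [Nm m1]] mmax; exists m => //; split; first by exists 1.
move=> m' mm'; have [m'1|m'1] := boolP ((1 : S) \in m').
  by right=> x; have := @rpredZ S S^o m' x _ m'1; rewrite /GRing.scale/= mulr1.
have T' : {subset N <= m'} /\ (1 : S) \notin m' by split=> // x /Nm /mm'.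
have /asboolP ? := mmax (exist _ m' T' : T) (asboolT mm').
by left.
Qed.

Let bi_inv (S : pzRingType) (u : S) := exists y : S, y * u = 1 /\ u * y = 1.

Lemma jacobson_linv (S : pzRingType) (x : S) :
  x \in jacobson S -> exists y : S, y * (1 - x) = 1.
Proof.
move=> /jacobsonP xJ; apply: contrapT => noinv.
have [|m mmax sub] := @exists_maximal S (cyclic_submod (1 - x : S^o)).
  by apply/negP => /cyclic_submodP[y y1]; apply: noinv; exists y.
have xm := xJ m mmax; case: (mmax) => -[z zm] _; move/negP: zm; apply.
have : 1 - x \in m.
  by apply: sub; apply/cyclic_submodP; exists 1; rewrite scale1r.
move=> m1; have {}m1 : (1 : S) \in m.
  by rewrite -[1](subrK x); exact: (@rpredD S^o m).
by have := @rpredZ S S^o m z _ m1; rewrite /GRing.scale/= mulr1.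
Qed.

Lemma jacobson_inv (S : pzRingType) (x : S) :
  x \in jacobson S -> bi_inv (1 - x).
Proof.
move=> xJ; have [y yx] := jacobson_linv xJ.
have yE : 1 - (- y) * x = y.
  by move: yx; rewrite mulrBr mulr1 => <-; rewrite mulNr opprK subrK.
have [z zy] := jacobson_linv (jacobsonMl (- y) xJ).
exists y; split=> //; rewrite yE in zy.
by have := congr1 ( *%R z) yx; rewrite mulrA zy mul1r mulr1 => ->.
Qed.

Lemma linv_jacobson (S : pzRingType) (x : S) :
  (forall a : S, exists y : S, y * (1 - a * x) = 1) -> x \in jacobson S.
Proof.
move=> inv; apply/jacobsonP => m [[z zm] mmax].
apply/negPn/negP => xm.
pose U : pred S^o := fun y => `[< exists a : S, y - a * x \in m >].
have UP y : reflect (exists a : S, y - a * x \in m) (y \in U).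
  exact: asboolP.
have Ucl : GRing.submod_closed U.
  split.
    by apply/UP; exists 0; rewrite mul0r subrr; exact: (@rpred0 S^o m).
  move=> c s t /UP[a as_] /UP[b bt]; apply/UP; exists (c * a + b).
  have -> : c *: s + t - (c * a + b) * x = c *: (s - a * x) + (t - b * x).
    by rewrite mulrDl opprD addrACA scalerBr -mulrA.
  exact: (@rpredD S^o m _ _ (rpredZ c as_) bt).
have mU : {subset m <= Submodule Ucl}.
  by move=> y ym; apply/UP; exists 0; rewrite mul0r subr0.
have [Um|UT] := mmax _ mU.
  case/negP: xm; apply: Um; apply/UP; exists 1.
  by rewrite mul1r subrr; exact: (@rpred0 S^o m).
have /UP[a am] := UT 1; have [y y1] := inv a; case/negP: zm.
have := @rpredZ S S^o m (z * y) _ am.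
by rewrite /GRing.scale/= -mulrA y1 mulr1.
Qed.

Let bi_inv_swap (S : pzRingType) (a b : S) :
  bi_inv (1 - a * b) -> bi_inv (1 - b * a).
Proof.
move=> [y [y1 y2]]; exists (1 + b * y * a); split.
  have e : b * y * a * (1 - b * a) = b * a.
    transitivity (b * (y * (1 - a * b)) * a); last by rewrite y1 mulr1.
    by rewrite !(mulrBr, mulrBl, mulr1, mulrA).
  by rewrite mulrDl mul1r e subrK.
have e : (1 - b * a) * (b * y * a) = b * a.
  transitivity (b * ((1 - a * b) * y) * a); last by rewrite y2 mulr1.
  by rewrite !(mulrBr, mulrBl, mul1r, mulr1, mulrA).
by rewrite mulrDr mulr1 e subrK.
Qed.

Lemma jacobson_invP (S : pzRingType) (x : S) :
  x \in jacobson S <-> forall a : S, bi_inv (1 - a * x).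
Proof.
split=> [xJ a|inv]; first exact/jacobson_inv/jacobsonMl.
by apply: linv_jacobson => a; have [y [y1 _]] := inv a; exists y.
Qed.

Lemma jacobson_converse (S : pzRingType) (x : S) :
  ((x : S^c) \in jacobson S^c) = (x \in jacobson S).
Proof.
apply/idP/idP => /jacobson_invP inv; apply/jacobson_invP => a.
  have [y [y1 y2]] := inv a.
  by apply: bi_inv_swap; exists y.
by have [y [y1 y2]] := bi_inv_swap (inv a); exists y.
Qed.

End JacobsonConverse.

(* The coordinate data of a formal matrix ring: the groups [B i j], and the   *)
(* products [B i j * B j k -> B i k]. The ring [R_i] is [B i i] with the      *)
(* product [fmul i i i]; the products [fmul i i j] and [fmul i j j] are the   *)
(* bimodule actions on [B i j]. The map [fmul i j k] is a homomorphism of     *)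
(* R_i-R_k-bimodules on the tensor product over [R_j]: it is biadditive by    *)
(* [fmulDl] and [fmulDr], and the instances (i,j,j,k), (i,i,j,k), (i,j,k,k)   *)
(* of [fmulA] say that it is balanced over [R_j] and linear on both sides.    *)
Record formal_datum (n : nat) := FormalDatum {
  bimod :> 'I_n -> 'I_n -> zmodType;
  fmul : forall i j k, bimod i j -> bimod j k -> bimod i k;
  fone : forall i, bimod i i;
  fmulDl : forall i j k (a a' : bimod i j) (b : bimod j k),
    fmul (a + a') b = fmul a b + fmul a' b;
  fmulDr : forall i j k (a : bimod i j) (b b' : bimod j k),
    fmul a (b + b') = fmul a b + fmul a b';
  fmulA : forall i j k l (a : bimod i j) (b : bimod j k) (c : bimod k l),
    fmul a (fmul b c) = fmul (fmul a b) c;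
  fmul1l : forall i j (b : bimod i j), fmul (fone i) b = b;
  fmul1r : forall i j (b : bimod i j), fmul b (fone j) = b
}.

Arguments fmul {n f i j k} a b.
Arguments fone {n} f i.

Definition coord_ring n (B : formal_datum n) (i : 'I_n) : Type := B i i.

Section CoordRing.
Variables (n : nat) (B : formal_datum n) (i : 'I_n).

HB.instance Definition _ := GRing.Zmodule.on (coord_ring B i).

Definition coord_mul (a b : coord_ring B i) : coord_ring B i := fmul a b.

Lemma coord_mulA : associative coord_mul.
Proof. by move=> a b c; exact: fmulA. Qed.
Lemma coord_mul1l : left_id (fone B i : coord_ring B i) coord_mul.
Proof. by move=> a; exact: fmul1l. Qed.
Lemma coord_mul1r : right_id (fone B i : coord_ring B i) coord_mul.
Proof. by move=> a; exact: fmul1r. Qed.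
Lemma coord_mulDl : left_distributive coord_mul +%R.
Proof. by move=> a b c; exact: fmulDl. Qed.
Lemma coord_mulDr : right_distributive coord_mul +%R.
Proof. by move=> a b c; exact: fmulDr. Qed.

HB.instance Definition _ := GRing.Zmodule_isPzRing.Build (coord_ring B i)
  coord_mulA coord_mul1l coord_mul1r coord_mulDl coord_mulDr.

End CoordRing.

Definition coord_lmod n (B : formal_datum n) (i j : 'I_n) : Type := B i j.

Section CoordLmod.
Variables (n : nat) (B : formal_datum n) (i j : 'I_n).

HB.instance Definition _ := GRing.Zmodule.on (coord_lmod B i j).

Definition coord_scale (a : coord_ring B i) (x : coord_lmod B i j) :
  coord_lmod B i j := fmul a x.

Lemma coord_scaleA a b x : coord_scale a (coord_scale b x) = coord_scale (a * b) x.
Proof. exact: fmulA. Qed.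
Lemma coord_scale1 : left_id 1 coord_scale.
Proof. by move=> x; exact: fmul1l. Qed.
Lemma coord_scaleDr : right_distributive coord_scale +%R.
Proof. by move=> a x y; exact: fmulDr. Qed.
Lemma coord_scaleDl x : {morph coord_scale^~ x : a b / a + b}.
Proof. by move=> a b; exact: fmulDl. Qed.

HB.instance Definition _ := GRing.Zmodule_isLmodule.Build (coord_ring B i)
  (coord_lmod B i j) coord_scaleA coord_scale1 coord_scaleDr coord_scaleDl.

End CoordLmod.

Record formal_matrix_ring (n : nat) := FormalMatrixRing {
  fmr_datum :> formal_datum n;
  fmr_local : forall i : 'I_n, local_ring (coord_ring fmr_datum i)
}.

Definition fmatrix n (B : formal_datum n) : Type :=
  {dffun forall p : 'I_n * 'I_n, B p.1 p.2}.

Section FormalMatrix.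
Variables (n : nat) (B : formal_datum n).
Local Notation FM := (fmatrix B).

HB.instance Definition _ := Choice.on FM.

Definition entry (x : FM) (i j : 'I_n) : B i j := x (i, j).

Definition fmat (F : forall i j, B i j) : FM :=
  [ffun p : 'I_n * 'I_n => F p.1 p.2 : B p.1 p.2].

Lemma fmatE F i j : entry (fmat F) i j = F i j.
Proof. by rewrite /entry ffunE. Qed.

Lemma fmatrixP (x y : FM) : (forall i j, entry x i j = entry y i j) -> x = y.
Proof. by move=> xy; apply/ffunP => -[i j]; exact: xy. Qed.

Definition fmat0 : FM := fmat (fun i j => 0).
Definition fmat_opp (x : FM) : FM := fmat (fun i j => - entry x i j).
Definition fmat_add (x y : FM) : FM := fmat (fun i j => entry x i j + entry y i j).

Lemma fmat_addA : associative fmat_add.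
Proof. by move=> x y z; apply: fmatrixP => i j; rewrite !fmatE addrA. Qed.
Lemma fmat_addC : commutative fmat_add.
Proof. by move=> x y; apply: fmatrixP => i j; rewrite !fmatE addrC. Qed.
Lemma fmat_add0 : left_id fmat0 fmat_add.
Proof. by move=> x; apply: fmatrixP => i j; rewrite !fmatE add0r. Qed.
Lemma fmat_addN : left_inverse fmat0 fmat_opp fmat_add.
Proof. by move=> x; apply: fmatrixP => i j; rewrite !fmatE addNr. Qed.

HB.instance Definition _ :=
  GRing.isZmodule.Build FM fmat_addA fmat_addC fmat_add0 fmat_addN.

Lemma entry0 i j : entry (0 : FM) i j = 0.
Proof. exact: fmatE. Qed.
Lemma entryN (x : FM) i j : entry (- x) i j = - entry x i j.
Proof. exact: fmatE. Qed.
Lemma entryD (x y : FM) i j : entry (x + y) i j = entry x i j + entry y i j.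
Proof. exact: fmatE. Qed.

(* The scalar matrix unit: [1] of [R_i] if [i = j], and [0] otherwise.        *)
Definition fdelta (i j : 'I_n) : B i j :=
  if i =P j is ReflectT e then ecast k (B i k) e (fone B i) else 0.

Definition fmat1 : FM := fmat fdelta.

Definition fmat_mul (x y : FM) : FM :=
  fmat (fun i k => \sum_(j < n) fmul (entry x i j) (entry y j k)).

Lemma fdelta_diag i : fdelta i i = fone B i.
Proof. by rewrite /fdelta; case: eqP => // e; rewrite eq_axiomK. Qed.

Lemma fdelta_off i j : i != j -> fdelta i j = 0.
Proof. by rewrite /fdelta; case: eqP. Qed.

Lemma fmul0l i j k (b : B j k) : fmul (0 : B i j) b = 0.
Proof. by apply: (addIr (fmul 0 b)); rewrite -fmulDl !add0r. Qed.

Lemma fmul0r i j k (a : B i j) : fmul a (0 : B j k) = 0.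
Proof. by apply: (addIr (fmul a 0)); rewrite -fmulDr !add0r. Qed.

Lemma fmul_suml i j k (I : Type) (r : seq I) (P : pred I) (F : I -> B i j)
    (b : B j k) :
  fmul (\sum_(t <- r | P t) F t) b = \sum_(t <- r | P t) fmul (F t) b.
Proof.
by apply: (big_morph (fun a => fmul a b)) => [a a'|]; [exact: fmulDl|exact: fmul0l].
Qed.

Lemma fmul_sumr i j k (I : Type) (r : seq I) (P : pred I) (F : I -> B j k)
    (a : B i j) :
  fmul a (\sum_(t <- r | P t) F t) = \sum_(t <- r | P t) fmul a (F t).
Proof.
by apply: (big_morph (fmul a)) => [b b'|]; [exact: fmulDr|exact: fmul0r].
Qed.

Lemma fmat_mulA : associative fmat_mul.
Proof.
move=> x y z; apply: fmatrixP => i l; rewrite !fmatE.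
under eq_bigr do rewrite fmatE fmul_sumr.
under [RHS]eq_bigr do rewrite fmatE fmul_suml.
rewrite exchange_big; apply: eq_bigr => k _; apply: eq_bigr => j _.
exact: fmulA.
Qed.

Lemma fmat_mul1l : left_id fmat1 fmat_mul.
Proof.
move=> x; apply: fmatrixP => i k; rewrite fmatE (bigD1 i)//= fmatE fdelta_diag.
rewrite fmul1l big1 ?addr0// => j ji.
by rewrite fmatE fdelta_off 1?eq_sym// fmul0l.
Qed.

Lemma fmat_mul1r : right_id fmat1 fmat_mul.
Proof.
move=> x; apply: fmatrixP => i k; rewrite fmatE (bigD1 k)//= fmatE fdelta_diag.
rewrite fmul1r big1 ?addr0// => j jk.
by rewrite fmatE fdelta_off// fmul0r.
Qed.

Lemma fmat_mulDl : left_distributive fmat_mul +%R.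
Proof.
move=> x y z; apply: fmatrixP => i k; rewrite entryD !fmatE -big_split.
by apply: eq_bigr => j _; rewrite entryD fmulDl.
Qed.

Lemma fmat_mulDr : right_distributive fmat_mul +%R.
Proof.
move=> x y z; apply: fmatrixP => i k; rewrite entryD !fmatE -big_split.
by apply: eq_bigr => j _; rewrite entryD fmulDr.
Qed.

HB.instance Definition _ := GRing.Zmodule_isPzRing.Build FM
  fmat_mulA fmat_mul1l fmat_mul1r fmat_mulDl fmat_mulDr.

Lemma entryM (x y : FM) i k :
  entry (x * y) i k = \sum_(j < n) fmul (entry x i j) (entry y j k).
Proof. exact: fmatE. Qed.

Definition canon_idem (i : 'I_n) : FM :=
  fmat (fun j k => if j == i then fdelta j k else 0).

(* In the regular module of [FM^c], [a *: v] is the product [v * a] of [FM],  *)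
(* so the cyclic submodule generated by e_i is the right ideal e_i R.         *)
Definition row_module (i : 'I_n) : lmodType FM^c :=
  submod_of (cyclic_submod (canon_idem i : FM^c^o)).

Definition col_module (i : 'I_n) : lmodType FM :=
  submod_of (cyclic_submod (canon_idem i : FM^o)).

Lemma row_idealP (i : 'I_n) (x : FM) :
  (x : FM^c^o) \in cyclic_submod (canon_idem i : FM^c^o) <->
  exists r : FM, x = canon_idem i * r.
Proof. by split=> [/cyclic_submodP|? ]; last exact/cyclic_submodP. Qed.

Definition basic : Prop :=
  forall i j : 'I_n, isomorphic (row_module i) (row_module j) -> i = j.

Definition nakayama_perm (pi : 'S_n) : Prop :=
  forall i : 'I_n,
    isomorphic (submod_of (socle (row_module i))) (topmod (row_module (pi i)))
    /\
    isomorphic (submod_of (socle (col_module (pi i)))) (topmod (col_module i)).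

Definition right_socle_essential : Prop := essential (socle (FM^c^o)).

End FormalMatrix.

(* Main.v *)
From HB Require Import structures.
Require Import Defs.
From mathcomp Require Import all_boot perm all_algebra.
From mathcomp Require Import boolp.

Set Implicit Arguments.
Unset Strict Implicit.
Unset Printing Implicit Defensive.

Import GRing.Theory.
Local Open Scope ring_scope.

(** Write e_i for the canonical idempotents and j for pi(i).  If a nonzero a in
    R_i annihilates B_{i,j}, then the nonzero right ideal aR satisfies
    aRe_j = aB_{i,j} = 0.  As the right socle is essential, aR contains a nonzero
    element x of it, and x = e_i x lies in soc(e_iR) because homomorphisms map
    socles into socles ([socle_morph]).  Hence soc(e_iR), which is isomorphic to
    top(e_jR), has a nonzero element that generates a submodule annihilated by
    e_j.  This is impossible, as e_j annihilates no nonzero submodule of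
    top(e_jR) ([top_cyclic_idem_eq0]): in terms of left modules over the
    converse ring, if all eas lie in the Jacobson radical, then so does s = se,
    since 1 - (as)e is left invertible whenever 1 - e(as) is. *)

(** * The Jacobson radical *)

Lemma jacobsonD (S : pzRingType) (x y : S) :
  x \in jacobson S -> y \in jacobson S -> x + y \in jacobson S.
Proof.
move=> /jacobsonP xJ /jacobsonP yJ; apply/jacobsonP => m mm.
exact: (@rpredD S^o m _ _ (xJ m mm) (yJ m mm)).
Qed.

Lemma jacobson0 (S : pzRingType) : (0 : S) \in jacobson S.
Proof. by apply/jacobsonP => m _; exact: (@rpred0 S^o m). Qed.

(** The radical is defined by maximal left ideals; stability under right
    multiplication comes from its left-right symmetry. *)
Lemma jacobsonMr (S : pzRingType) (x a : S) :
  x \in jacobson S -> x * a \in jacobson S.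
Proof.
rewrite -(@jacobson_converse S x) -(@jacobson_converse S (x * a)).
exact: (@jacobsonMl S^c a x).
Qed.

(** If y is a left inverse of 1 - eas, then 1 + (as)ye is a left inverse of
    1 - (as)e = 1 - as. *)
Lemma jacobson_corner (S : pzRingType) (e s : S) :
  s * e = s -> (forall a, e * (a * s) \in jacobson S) -> s \in jacobson S.
Proof.
move=> se esJ; apply: linv_jacobson => a.
have [y y1] := jacobson_linv (esJ a).
exists (1 + a * s * (y * e)).
have ease : e * (1 - a * s) = (1 - e * (a * s)) * e.
  by rewrite mulrBr mulrBl mulr1 mul1r -!mulrA se.
rewrite mulrDl mul1r -mulrA -(mulrA y) ease (mulrA y) y1 mul1r.
by rewrite -mulrA se subrK.
Qed.

(** * Socles and tops *)

Lemma submod_valZ (S : pzRingType) (M : lmodType S) (N : submodule M)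
    (a : S) (u : submod_of N) : submod_val (a *: u) = a *: submod_val u.
Proof. by []. Qed.

Lemma submod_val_eq0 (S : pzRingType) (M : lmodType S) (N : submodule M)
    (u : submod_of N) : submod_val u = 0 -> u = 0.
Proof. by move=> u0; apply: val_inj; rewrite raddf0. Qed.

Section ImageOfSubmodule.
Variables (S : pzRingType) (M M' : lmodType S) (f : {linear M -> M'}).

Definition image_submod_pred (N : submodule M) : pred M' :=
  fun v => `[< exists2 z, z \in N & v = f z >].

Lemma image_submodP (N : submodule M) v :
  reflect (exists2 z, z \in N & v = f z) (v \in image_submod_pred N).
Proof. exact: asboolP. Qed.

Lemma image_submod_closed (N : submodule M) : GRing.submod_closed (image_submod_pred N).
Proof.
split=> [|a x y /image_submodP[u uN ->] /image_submodP[v vN ->]].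
  by apply/image_submodP; exists 0; rewrite ?rpred0 ?raddf0.
by apply/image_submodP; exists (a *: u + v); rewrite ?rpredD ?rpredZ ?linearP.
Qed.

Definition image_submod (N : submodule M) : submodule M' := Submodule (image_submod_closed N).

Definition lift_submod_pred (N : submodule M) (N' : submodule M') : pred M :=
  fun z => (z \in N) && (f z \in N').

Lemma lift_submod_closed (N : submodule M) (N' : submodule M') : GRing.submod_closed (lift_submod_pred N N').
Proof.
split=> [|a x y /andP[xN xN'] /andP[yN yN']]; rewrite unfold_in.
  by rewrite /lift_submod_pred raddf0 !rpred0.
by rewrite /lift_submod_pred linearP !rpredD ?rpredZ.
Qed.

Definition lift_submod (N : submodule M) (N' : submodule M') : submodule M :=
  Submodule (lift_submod_closed N N').

Lemma simple_image (N : submodule M) (y : M) :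
  simple_submod N -> y \in N -> f y != 0 -> simple_submod (image_submod N).
Proof.
move=> [_ Nmin] yN fy0; split.
  by exists (f y) => //; apply/image_submodP; exists y.
move=> N' N'sub.
have [|z0|Nsub] := Nmin (lift_submod N N'); first by move=> z /andP[].
  left=> w wN'; have /image_submodP[z zN wE] := N'sub w wN'.
  rewrite wE in wN' *.
  by rewrite (z0 z) ?raddf0 //; apply/andP.
by right=> w /image_submodP[z /Nsub /andP[_ ?] ->].
Qed.

(** A homomorphism maps a simple submodule to zero or to a simple submodule. *)
Lemma socle_morph (x : M) : x \in socle M -> f x \in socle M'.
Proof.
move=> /socleP[s [-> sN]]; rewrite linear_sum big_seq rpred_sum // => y ys.
have [N Ns yN] := sN y ys.
have [->|fy0] := eqVneq (f y) 0; first exact: rpred0.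
apply/socleP; exists [:: f y]; split; first by rewrite big_seq1.
move=> z; rewrite inE => /eqP ->.
exists (image_submod N); first exact: simple_image fy0.
by apply/image_submodP; exists y.
Qed.

End ImageOfSubmodule.

Section CyclicIdempotent.
Variables (S : pzRingType) (e : S).

Let Se : submodule S^o := cyclic_submod (e : S^o).

Lemma cyclic_proj_subproof (x : S^o) : (x : S) *: (e : S^o) \in Se.
Proof. by apply/cyclic_submodP; exists x. Qed.

Definition cyclic_proj (x : S^o) : submod_of Se :=
  SubmodOf (cyclic_proj_subproof x).

Lemma cyclic_proj_linear : linear cyclic_proj.
Proof.
by move=> a x y; apply: val_inj; rewrite linearP /= scalerDl scalerA.
Qed.

HB.instance Definition _ :=
  GRing.isLinear.Build S S^o (submod_of Se) _ cyclic_proj cyclic_proj_linear.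

Lemma radmod_jacobson (u : submod_of Se) :
  u \in radmod (submod_of Se) -> (\val u : S) \in jacobson S.
Proof.
move=> /radmodP[t [-> tJ]]; rewrite linear_sum big_seq.
apply: (big_ind (fun z : S => z \in jacobson S)) => [|x y|p pt].
- exact: jacobson0.
- exact: jacobsonD.
by rewrite linearZ; exact: jacobsonMr (tJ p pt).
Qed.

Hypothesis ee : e * e = e.

Lemma jacobson_radmod (u : submod_of Se) :
  (\val u : S) \in jacobson S -> u \in radmod (submod_of Se).
Proof.
move=> uJ.
have eSe : (e : S^o) \in Se by apply/cyclic_submodP; exists 1; rewrite scale1r.
apply/radmodP; exists [:: ((\val u : S), SubmodOf eSe)]; split.
  rewrite big_seq1; apply: val_inj; rewrite linearZ /=.
  have /cyclic_submodP[c ->] := valP u.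
  by rewrite /GRing.scale /= -mulrA ee.
by move=> p; rewrite inE => /eqP ->.
Qed.

(** The radical of Se is its intersection with J(S), and whether s = se lies in
    J(S) is detected by eSs ([jacobson_corner]). *)
Lemma top_cyclic_idem_eq0 (y : topmod (submod_of Se)) :
  (forall a : S, e *: (a *: y) = 0) -> y = 0.
Proof.
rewrite -[y]reprK; move: (repr y) => u eau.
have zeroP (v : submod_of Se) :
    \pi_(quotmod (radmod (submod_of Se)))%qT v = 0
    <-> v \in radmod (submod_of Se).
  rewrite -[X in _ = X](raddf0 (\pi_(quotmod (radmod (submod_of Se)))%qT)).
  by rewrite pi_quotmodP subr0.
apply/zeroP/jacobson_radmod/(@jacobson_corner _ e) => [|a].
  by have /cyclic_submodP[c ->] := valP u; rewrite /GRing.scale /= -mulrA ee.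
suff /radmod_jacobson : e *: (a *: u) \in radmod (submod_of Se).
  by rewrite !linearZ.
apply/zeroP; rewrite -[RHS](eau a).
by rewrite -!quotmod_scaleE.
Qed.

End CyclicIdempotent.

(** * Rows of formal matrix rings *)

Section Rows.
Variables (n : nat) (B : formal_datum n).

Lemma entry_canon_mul i (x : fmatrix B) j k :
  entry (canon_idem B i * x) j k = if j == i then entry x j k else 0.
Proof.
rewrite entryM (bigD1 j) //= big1 => [|l lj].
  rewrite addr0 /canon_idem fmatE; case: eqP => _; last exact: fmul0l.
  by rewrite fdelta_diag fmul1l.
rewrite /canon_idem fmatE; case: eqP => _; last exact: fmul0l.
by rewrite fdelta_off 1?eq_sym // fmul0l.
Qed.

Lemma entry_mul_canon i (x : fmatrix B) j k :
  entry (x * canon_idem B i) j k = if k == i then entry x j k else 0.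
Proof.
rewrite entryM (bigD1 k) //= big1 => [|l lk].
  rewrite addr0 /canon_idem fmatE; case: eqP => _; last exact: fmul0r.
  by rewrite fdelta_diag fmul1r.
rewrite /canon_idem fmatE; case: eqP => _; last exact: fmul0r.
by rewrite fdelta_off // fmul0r.
Qed.

Lemma canon_idemK i : canon_idem B i * canon_idem B i = canon_idem B i.
Proof.
apply: fmatrixP => j k; rewrite entry_canon_mul /canon_idem !fmatE.
by case: eqP.
Qed.

(** The matrix with a at position (i,i) and zeros elsewhere.  Sandwiching a
    between matrix units supplies the casts along k = i and l = i. *)
Definition diag_single i (a : B i i) : fmatrix B :=
  fmat (fun k l => fmul (fmul (fdelta B k i) a) (fdelta B i l)).

Lemma diag_single_eq0 i (a : B i i) : diag_single a = 0 -> a = 0.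
Proof.
move=> /(congr1 (fun x => entry x i i)).
by rewrite entry0 fmatE fdelta_diag fmul1l fmul1r.
Qed.

Lemma canon_mul_diag_single i (a : B i i) :
  canon_idem B i * diag_single a = diag_single a.
Proof.
apply: fmatrixP => k l; rewrite entry_canon_mul; case: eqP => // /eqP ki.
by rewrite fmatE fdelta_off // !fmul0l.
Qed.

Lemma diag_single_mul_canon i j (a : B i i) (r : fmatrix B) :
  (forall b : B i j, fmul a b = 0) ->
  diag_single a * r * canon_idem B j = 0.
Proof.
move=> aB; apply: fmatrixP => k l; rewrite entry_mul_canon entry0.
case: eqP => // ->; rewrite entryM big1 // => m _.
by rewrite fmatE -!fmulA aB fmul0r.
Qed.

End Rows.

Theorem corollary14 (n : nat) (R : formal_matrix_ring n) (pi : 'S_n) :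
  basic R -> nakayama_perm R pi -> right_socle_essential R ->
  forall i : 'I_n, i <> pi i -> faithful (coord_lmod R i (pi i)).
Proof.
move=> _ nak ess i _ a aB; apply/eqP/negPn/negP => a0.
pose A : fmatrix R := @diag_single n R i a.
have [|x [/cyclic_submodP[r xE] xsoc x0]] :=
    ess (cyclic_submod (A : (fmatrix R)^c^o)).
  exists A; first by apply/cyclic_submodP; exists 1; rewrite scale1r.
  by apply: contra a0 => /eqP A0; apply/eqP; exact: (@diag_single_eq0 n R i a).
have [[g [g' gK _]] _] := nak i.
pose X : submod_of (socle (row_module R i)) :=
  SubmodOf (socle_morph (cyclic_proj (canon_idem R i : (fmatrix R)^c)) xsoc).
have XE : submod_val (submod_val X) = x.
  change (canon_idem R i * (x : fmatrix R) = x); rewrite xE.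
  change (canon_idem R i * (A * (r : fmatrix R)) = A * r).
  by rewrite mulrA canon_mul_diag_single.
suff X0 : X = 0 by case/eqP: x0; rewrite -XE X0.
apply: (can_inj gK); rewrite raddf0.
apply: top_cyclic_idem_eq0 => [|s]; first exact: canon_idemK.
rewrite -!linearZ; have -> : (canon_idem R (pi i) : (fmatrix R)^c) *: (s *: X) = 0.
  apply: submod_val_eq0; apply: submod_val_eq0.
  rewrite !submod_valZ XE xE.
  change (A * (r : fmatrix R) * (s : fmatrix R) * canon_idem R (pi i) = 0).
  by rewrite -(mulrA A); exact: diag_single_mul_canon.
exact: raddf0.
Qed.
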